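(* Assume that there exist functions $\phi,\phi^*:\mathbb X\to[1,+\infty)$ such that the process $X$ admits an exponential $\phi$-coupling, the dual process $X^*$ admits an exponential $\phi^*$-coupling, and $\phi\asymp\phi^*$. Let $\beta>0$ be the exponent in the exponential $\phi$-coupling of $X$, let $\pi$ be the unique invariant probability measure of $X$, and assume $\phi\in L_1(\mathbb X,\pi)$. Then, for every $p\in[2,+\infty)$ and every $\gamma>0$ with $\gamma<\frac{\beta}{2p-1}$, the process $X$ satisfies $GB_p(\gamma)$.
   Context: $(\mathbb X,\rho)$ is a locally compact metric space and $X=(X_t)_{t\ge0}$ is a time-homogeneous, stochastically continuous, strong Markov process in $\mathbb X$ with càdlàg trajectories and transition function $P_t(x,dy)$. All functions on $\mathbb X$ are Borel measurable. A probability measure $\pi$ is invariant for $X$ if $\int_{\mathbb X}P_t(x,\cdot)\,\pi(dx)=\pi$ for all $t\ge0$. Coupling: for probability measures $\mu,\nu$ on $\mathbb X$, a $(\mu,\nu)$-coupling for a Markov process $X$ is any two-component process $Z=(Z^1,Z^2)$ such that $Z^1$ has the law of $X$ with initial distribution $\mu$ and $Z^2$ has the law of $X$ with initial distribution $\nu$. For a function $\phi:\mathbb X\to[1,+\infty)$, a process $X$ admits an exponential $\phi$-coupling if there exist an invariant probability measure $\pi$ for it and constants $C_\phi>0$, $\beta>0$ (the exponent) such that for every $x\in\mathbb X$ there is a $(\delta_x,\pi)$-coupling $Z=(Z^1,Z^2)$ with $E\big[(\phi(Z^1_t)+\phi(Z^2_t))\mathbf 1_{Z^1_t\ne Z^2_t}\big]\le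 C_\phi e^{-\beta t}\phi(x)$ for all $t\ge0$. The same definition is applied to the dual process $X^*$ and $\phi^*$. Dual process: let $(\tilde X_t)_{t\in\mathbb R}$ be a stationary Markov process with transition function $P_t(x,dy)$ and $\tilde X_0\sim\pi$. The dual process is $X^*_t=\tilde X_{-t}$, $t\in\mathbb R$, which is again a time-homogeneous Markov process. $\phi\asymp\psi$ means $\inf_x\phi(x)/\psi(x)>0$ and $\sup_x\phi(x)/\psi(x)<+\infty$. For $p\in(1,+\infty)$, $L_p=L_p^{\mathbb C}(\mathbb X,\pi)$ with norm $\|\cdot\|_p$, $L_p^0=\{f\in L_p:\int_{\mathbb X} f\,d\pi=0\}$, and $T_tf(x)=\int_{\mathbb X} f(y)P_t(x,dy)$. For $\gamma>0$, $X$ satisfies $GB_p(\gamma)$ if there is a constant $C\ge0$ with $\|T_tf\|_p\le Ce^{-\gamma t}\|f\|_p$ for all $t\ge0$, $f\in L_p^0$. *)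

(* Defs.v *)
From HB Require Import structures.
From mathcomp Require Import all_boot all_order all_algebra.
Set Warnings "-notation-overridden,-notation-incompatible-prefix,-ambiguous-paths".
From mathcomp Require Import all_classical all_reals all_analysis.
From mathcomp Require Export complex.

Set Implicit Arguments.
Unset Strict Implicit.
Unset Printing Implicit Defensive.

Import Order.TTheory GRing.Theory Num.Theory.
Import numFieldNormedType.Exports.

Local Open Scope classical_set_scope.
Local Open Scope ring_scope.

HB.mixin Record isBorel (d : measure_display) (R : realType) T
    & Metric R T & Measurable d T := {
  borelE : (measurable : set (set T)) = <<s [set A : set T | open A] >> }.

#[short(type="borelMetricType")]
HB.structure Definition BorelMetric (d : measure_display) (R : realType) :=
  {T of Metric R T & Measurable d T & isBorel d R T}.

(* Time is indexed by [R]; one-sided families [P], [X], [Z] are only ever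
   constrained at nonnegative times. *)

Section MarkovLaws.
Context (d : measure_display) (R : realType) (T : measurableType d).
Implicit Types (P : R -> R.-pker T ~> T) (pi : probability T R).

Record transition_function P : Prop := TransitionFunction {
  transition0 : forall x A, measurable A -> P 0 x A = \d_x A ;
  chapman_kolmogorov : forall s t x A, 0 <= s -> 0 <= t -> measurable A ->
    P (s + t) x A = (\int[P s x]_y P t y A)%E }.

Definition invariant P pi : Prop :=
  forall t A, 0 <= t -> measurable A -> (\int[pi]_x P t x A)%E = pi A.

(* For [s = [:: (h1, A1); ...; (hn, An)]], [fdd P s x] is the probability that
   the process with transition function [P] started at [x] is in [A1] at time
   [h1], in [A2] at time [h1 + h2], and so on; [cylinder t0 s Y] is the
   corresponding event for the trajectories of [Y] from time [t0] on. *)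
Fixpoint fdd P (s : seq (R * set T)) (x : T) : \bar R :=
  match s with
  | [::] => 1%E
  | (h, A) :: s' => (\int[P h x]_(y in A) fdd P s' y)%E
  end.

Fixpoint cylinder (W : Type) (t0 : R) (s : seq (R * set T)) (Y : R -> W -> T) :
    set W :=
  match s with
  | [::] => setT
  | (h, A) :: s' => Y (t0 + h) @^-1` A `&` cylinder (t0 + h) s' Y
  end.

Definition has_law P (mu : {measure set T -> \bar R})
    (dW : measure_display) (W : measurableType dW) (Q : probability W R)
    (Z : R -> W -> T) : Prop :=
  (forall t, 0 <= t -> measurable_fun setT (Z t)) /\
  forall s : seq (R * set T),
    (forall hA, hA \in s -> 0 <= hA.1 /\ measurable hA.2) ->
    Q (cylinder 0 s Z) = (\int[mu]_x fdd P s x)%E.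

Definition coupling P (mu nu : {measure set T -> \bar R})
    (dW : measure_display) (W : measurableType dW) (Q : probability W R)
    (Z1 Z2 : R -> W -> T) : Prop :=
  has_law P mu Q Z1 /\ has_law P nu Q Z2.

(* The measurability requirement makes the expectation meaningful; it holds
   automatically when [T] is a separable metric space. *)
Definition exponential_coupling_with P (phi : T -> R) pi (beta : R) : Prop :=
  [/\ invariant P pi, 0 < beta &
    exists2 C : R, 0 < C &
    forall x : T, exists (dW : measure_display) (W : measurableType dW)
      (Q : probability W R) (Z1 Z2 : R -> W -> T),
      coupling P \d_x pi Q Z1 Z2 /\
      forall t, 0 <= t ->
        measurable [set w | Z1 t w <> Z2 t w] /\
        ('E_Q[(fun w => (phi (Z1 t w) + phi (Z2 t w)) *
                        \1_[set v | Z1 t v <> Z2 t v] w)%R]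
         <= (C * expR (- (beta * t)) * phi x)%:E)%E].

Definition exponential_coupling P (phi : T -> R) : Prop :=
  exists (pi : probability T R) (beta : R),
    exponential_coupling_with P phi pi beta.

Definition asymp_comparable (phi psi : T -> R) : Prop :=
  (0 < ereal_inf (range (fun x => (phi x / psi x)%:E)))%E /\
  (ereal_sup (range (fun x => (phi x / psi x)%:E)) < +oo)%E.

Section TwoSided.
Context (dW : measure_display) (W : measurableType dW).
Implicit Types (Q : probability W R) (Y : R -> W -> T).

Definition past Y (s : R) : set (set W) :=
  <<s [set E | exists u A,
         [/\ u <= s, measurable A & E = Y u @^-1` A]] >>.

Definition markov_two_sided P Q Y : Prop :=
  (forall t, measurable_fun setT (Y t)) /\
  forall s t E A, 0 <= t -> past Y s E -> measurable A ->
    Q (E `&` Y (s + t) @^-1` A) = (\int[Q]_(w in E) P t (Y s w) A)%E.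

Definition stationary Q Y : Prop :=
  forall (n : nat) (u : 'I_n -> R) (A : 'I_n -> set T) (h : R),
    (forall i, measurable (A i)) ->
    Q [set w | forall i, A i (Y (u i + h) w)] =
    Q [set w | forall i, A i (Y (u i) w)].

End TwoSided.

(* [Ps] is a transition function of the dual process [Y (- t)], where [Y] is the
   two-sided stationary process with transition function [P] and one-dimensional
   distribution [pi]. *)
Definition dual_transition_function P pi (Ps : R -> R.-pker T ~> T) : Prop :=
  transition_function Ps /\
  exists (dW : measure_display) (W : measurableType dW) (Q : probability W R)
    (Y : R -> W -> T),
    [/\ stationary Q Y, markov_two_sided P Q Y,
        forall A, measurable A -> Q (Y 0 @^-1` A) = pi A &
        markov_two_sided Ps Q (fun t => Y (- t))].

End MarkovLaws.

Section StrongMarkov.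
Context (d : measure_display) (R : realType) (T : borelMetricType d R).
Context (dW : measure_display) (W : measurableType dW).
Implicit Types (F : R -> set (set W)) (tau : W -> \bar R).

Definition filtration F : Prop :=
  (forall t, 0 <= t -> sigma_algebra setT (F t) /\ F t `<=` measurable) /\
  forall s t, 0 <= s -> s <= t -> F s `<=` F t.

Definition stopping_time F tau : Prop :=
  (forall w, (0 <= tau w)%E) /\
  forall t, 0 <= t -> F t [set w | (tau w <= t%:E)%E].

Definition stopped_sigma_algebra F tau : set (set W) :=
  [set E | measurable E /\
    forall t, 0 <= t -> F t (E `&` [set w | (tau w <= t%:E)%E])].

Definition cadlag (x : R -> T) : Prop :=
  (forall t, 0 <= t -> x s @[s --> t^'+] --> x t) /\
  (forall t, 0 < t -> exists l : T, x s @[s --> t^'-] --> l).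

(* [Px x] is the law of the process started at [x].  The Markov property at
   deterministic times is the case of a constant [tau].  Convergence in
   probability uses the outer probability, since the distance of two
   random elements need not be measurable if [T] is not separable. *)
Record strong_markov_process (P : R -> R.-pker T ~> T) F (X : R -> W -> T)
    (Px : T -> probability W R) : Prop := StrongMarkovProcess {
  smp_transition : transition_function P ;
  smp_filtration : filtration F ;
  smp_adapted : forall t A, 0 <= t -> measurable A -> F t (X t @^-1` A) ;
  smp_initial : forall x A, measurable A -> Px x (X 0 @^-1` A) = \d_x A ;
  smp_cadlag : forall w, cadlag (X ^~ w) ;
  smp_stochastically_continuous : forall x t (eps : R), 0 <= t -> 0 < eps ->
    mu_ext (Px x) [set w | eps <= mdist (X s w) (X t w)]
      @[s --> within [set s | 0 <= s] (nbhs t)] --> 0%E ;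
  smp_strong_markov : forall x tau t E A, stopping_time F tau -> 0 <= t ->
    stopped_sigma_algebra F tau E -> E `<=` [set w | (tau w < +oo)%E] ->
    measurable A ->
    Px x (E `&` [set w | A (X (fine (tau w) + t) w)]) =
    (\int[Px x]_(w in E) P t (X (fine (tau w)) w) A)%E }.

End StrongMarkov.

Section GrowthBound.
Context (d : measure_display) (R : realType) (T : measurableType d).
Implicit Types (P : R -> R.-pker T ~> T) (pi : probability T R) (f : T -> R[i]).

(* junk value when [f] is not integrable, like [Rintegral] *)
Definition cintegral (mu : {measure set T -> \bar R}) f : R[i] :=
  Complex (\int[mu]_x complex.Re (f x)) (\int[mu]_x complex.Im (f x)).

Definition cLnorm (mu : {measure set T -> \bar R}) (p : R) f : \bar R :=
  Lnorm mu p%:E (fun x => (Normc.normc (f x))%:E).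

Definition cLp (mu : {measure set T -> \bar R}) (p : R) f : Prop :=
  [/\ measurable_fun setT (fun x => complex.Re (f x)),
      measurable_fun setT (fun x => complex.Im (f x)) &
      (cLnorm mu p f < +oo)%E].

Definition cLp0 (mu : {measure set T -> \bar R}) (p : R) f : Prop :=
  cLp mu p f /\ cintegral mu f = 0.

(* For [f] in L_p of the invariant measure, [f] is [P t x]-integrable for almost
   every [x]; elsewhere the value is immaterial for L_p norms. *)
Definition semigroup P (t : R) f : T -> R[i] := fun x => cintegral (P t x) f.

Definition GB P pi (p gamma : R) : Prop :=
  exists2 C : R, 0 <= C &
  forall t f, 0 <= t -> cLp0 pi p f ->
    (cLnorm pi p (semigroup P t f) <=
     (C * expR (- (gamma * t)))%:E * cLnorm pi p f)%E.

End GrowthBound.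

(* Main.v *)
Require Import Defs.
From mathcomp Require Import all_boot all_order all_algebra.
From mathcomp Require Import all_classical all_reals all_analysis.
From mathcomp Require Import measurable_realfun ring lra.
Import Order.TTheory GRing.Theory Num.Theory.
Import numFieldNormedType.Exports.
Import HBNNSimple.
Local Open Scope classical_set_scope.
Local Open Scope ring_scope.

(** Since [f] has mean zero, [T_t f x] is the expectation of [f (Z1 t) - f (Z2 t)],
    which only charges the event [Z1 t <> Z2 t].  Writing [|f| = (|f|^p / phi)^(1/p)
    phi^(1/p)], Hoelder's inequality (here [p >= 2]) and the coupling bound give
      [|T_t f x|^p <= c e^(- beta t) phi x (T_t h x + \int h dpi)],
    with [h = |f|^p / phi].  Integrate in [pi]: by duality
    [\int phi T_t h dpi = \int h T*_t phi dpi], and the coupling of the dual process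
    together with the comparability of [phi] and [phi*] gives [T*_t phi <= M phi], so
    the right-hand side is [O(e^(- beta t)) \int |f|^p dpi].  The resulting rate
    [beta / p] is at least [beta / (2 p - 1)]. *)

(** * Integration against weighted mixtures of measures *)

(** The inner integral of a simple function is a finite sum over its values. Negative levels of [h]
    are empty, so every term is nonnegative and the sum passes through both integrals. *)
Lemma integral_mixture_fsum {R : realType} {dW dT : measure_display}
    {W : measurableType dW} {T : measurableType dT}
    (mu : {measure set W -> \bar R}) (c : W -> R)
    (K : W -> {measure set T -> \bar R}) (h : {nnsfun T >-> R}) :
  measurable_fun [set: W] c -> (forall w, 0 <= c w) ->
  (forall A, measurable A -> measurable_fun [set: W] (K ^~ A)) ->
  (\int[mu]_w ((c w)%:E * \int[K w]_y (h y)%:E))%E =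
  (\sum_(r \in range h)
     r%:E * \int[mu]_w ((c w)%:E * K w (h @^-1` [set r])))%E.
Proof.
move=> mc c0 mK.
have preim0 r : r < 0 -> h @^-1` [set r] = set0.
  move=> r0; apply/seteqP; split => // y /= hy.
  by move: r0; rewrite -hy ltNge fun_ge0.
have rK0 r w : (0 <= r%:E * ((c w)%:E * K w (h @^-1` [set r])))%E.
  have [r0|r0] := leP 0 r; first by rewrite !mule_ge0 ?lee_fin.
  by rewrite preim0 // measure0 !mule0.
have mcK r : measurable_fun [set: W] (fun w => (c w)%:E * K w (h @^-1` [set r]))%E.
  apply: emeasurable_funM; first exact/measurable_EFinP.
  exact: mK.
transitivity (\int[mu]_w
    (\sum_(r \in range h) r%:E * ((c w)%:E * K w (h @^-1` [set r])))%E)%E.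
  apply: eq_integral => w _.
  rewrite integralT_nnsfun sintegralE ge0_mule_fsumr; last first.
    move=> r; have [r0|r0] := leP 0 r; first by rewrite mule_ge0 // lee_fin.
    by rewrite preim0 // measure0 mule0.
  by apply: eq_fsbigr => r _; rewrite muleCA.
rewrite ge0_integral_fsum //; last first.
  by move=> r; apply: measurable_funeM.
apply: eq_fsbigr => r; rewrite inE => -[y _ <-].
rewrite ge0_integralZl //; last by rewrite lee_fin.
by move=> w _; rewrite mule_ge0 ?lee_fin.
Qed.

(** Monotone convergence is applied twice along the simple approximations of [h]: in each inner
    integral, then in the outer one. *)
Lemma integral_mixture_lim {R : realType} {dW dT : measure_display}
    {W : measurableType dW} {T : measurableType dT}
    (mu : {measure set W -> \bar R}) (c : W -> R)
    (K : W -> {measure set T -> \bar R}) (h : T -> \bar R)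
    (mh : measurable_fun [set: T] h) :
  measurable_fun [set: W] c -> (forall w, 0 <= c w) ->
  (forall A, measurable A -> measurable_fun [set: W] (K ^~ A)) ->
  (forall y, 0 <= h y)%E ->
  (\int[mu]_w ((c w)%:E * \int[K w]_y h y))%E =
  limn (fun n =>
    \int[mu]_w ((c w)%:E * \int[K w]_y (nnsfun_approx measurableT mh n y)%:E))%E.
Proof.
move=> mc c0 mK h0; set h_ := nnsfun_approx measurableT mh.
have mh_ n : measurable_fun [set: T] (EFin \o h_ n).
  exact: measurableT_comp.
have h_0 n y : (0 <= (h_ n y)%:E)%E by rewrite lee_fin.
have nd_h y m n : (m <= n)%N -> ((h_ m y)%:E <= (h_ n y)%:E)%E.
  by move=> mn; rewrite lee_fin; exact/lefP/nd_nnsfun_approx.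
have nd_K w m n : (m <= n)%N ->
    ((c w)%:E * \int[K w]_y (h_ m y)%:E <= (c w)%:E * \int[K w]_y (h_ n y)%:E)%E.
  move=> mn; apply: lee_wpmul2l; rewrite ?lee_fin //; apply: ge0_le_integral => //.
  - exact: mh_.
  - exact: mh_.
  - by move=> y _; exact: nd_h.
rewrite -monotone_convergence //; last 3 first.
- move=> n; apply: emeasurable_funM; first exact/measurable_EFinP.
  by apply: measurable_fun_integral_kernel => //; exact: mh_.
- by move=> n w _; rewrite mule_ge0 ?lee_fin // integral_ge0.
- by move=> w _ m n; exact: nd_K.
apply: eq_integral => w _; apply/esym/cvg_lim => //.
have cvgK : (\int[K w]_y (h_ n y)%:E @[n --> \oo] --> \int[K w]_y h y)%E.
  have -> : (\int[K w]_y h y = \int[K w]_y limn (fun n => (h_ n y)%:E))%E.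
    apply: eq_integral => y _; apply/esym/cvg_lim => //.
    exact: cvg_nnsfun_approx.
  apply: cvg_monotone_convergence => //.
  by move=> y _ m n; exact: nd_h.
exact: cvgeZl.
Qed.

(** Both sides depend on the mixtures only through their values on level sets of the same simple
    approximations of [h]. This extends identities on sets to nonnegative functions without building
    the mixture as a measure. *)
Lemma eq_integral_mixture {R : realType} {d1 d2 dT : measure_display}
    {W1 : measurableType d1} {W2 : measurableType d2} {T : measurableType dT}
    (mu1 : {measure set W1 -> \bar R}) (mu2 : {measure set W2 -> \bar R})
    (c1 : W1 -> R) (c2 : W2 -> R)
    (K1 : W1 -> {measure set T -> \bar R})
    (K2 : W2 -> {measure set T -> \bar R}) (h : T -> \bar R) :
  measurable_fun [set: W1] c1 -> (forall w, 0 <= c1 w) ->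
  (forall A, measurable A -> measurable_fun [set: W1] (K1 ^~ A)) ->
  measurable_fun [set: W2] c2 -> (forall w, 0 <= c2 w) ->
  (forall A, measurable A -> measurable_fun [set: W2] (K2 ^~ A)) ->
  measurable_fun [set: T] h -> (forall y, 0 <= h y)%E ->
  (forall A, measurable A ->
    (\int[mu1]_w ((c1 w)%:E * K1 w A) = \int[mu2]_w ((c2 w)%:E * K2 w A))%E) ->
  (\int[mu1]_w ((c1 w)%:E * \int[K1 w]_y h y) =
   \int[mu2]_w ((c2 w)%:E * \int[K2 w]_y h y))%E.
Proof.
move=> mc1 c10 mK1 mc2 c20 mK2 mh h0 K12.
rewrite !(integral_mixture_lim _ _ _ _ mh) //; congr (limn _).
apply/funext => n; rewrite !integral_mixture_fsum //.
by apply: eq_fsbigr => r _; rewrite K12.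
Qed.

(** * Change of variables for laws and joint laws *)

Lemma ge0_integral_law {R : realType} {dW dT : measure_display}
    {W : measurableType dW} {T : measurableType dT}
    (Q : {measure set W -> \bar R}) (mu : {measure set T -> \bar R})
    (Z : W -> T) (h : T -> \bar R) :
  measurable_fun [set: W] Z ->
  (forall A, measurable A -> Q (Z @^-1` A) = mu A) ->
  measurable_fun [set: T] h -> (forall y, 0 <= h y)%E ->
  (\int[Q]_w h (Z w) = \int[mu]_y h y)%E.
Proof.
move=> mZ ZE mh h0.
transitivity (\int[pushforward Q Z]_y h y)%E.
  by rewrite (ge0_integral_pushforward mZ).
by apply: eq_measure_integral => A mA _; exact: ZE.
Qed.

Lemma measurable_dirac_comp {R : realType} {dW dT : measure_display}
    {W : measurableType dW} {T : measurableType dT} (Z : W -> T) (A : set T) :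
  measurable_fun [set: W] Z -> measurable A ->
  measurable_fun [set: W] (fun w => \d_(Z w) A : \bar R).
Proof.
move=> mZ mA; apply/measurable_EFinP.
exact: measurableT_comp (measurable_indic _) mZ.
Qed.

(** The identity on rectangles is extended one variable at a time by [eq_integral_mixture].
    Evaluations at a point are written as integrals against Dirac masses to fit its form. *)
Lemma ge0_integral_joint_law {R : realType} {dW d1 d2 : measure_display}
    {W : measurableType dW} {T1 : measurableType d1} {T2 : measurableType d2}
    (Q : {measure set W -> \bar R}) (mu : {measure set T1 -> \bar R})
    (K : R.-pker T1 ~> T2) (Y : W -> T1) (Z : W -> T2)
    (g : T1 -> R) (h : T2 -> \bar R) :
  measurable_fun [set: W] Y -> measurable_fun [set: W] Z ->
  (forall B A, measurable B -> measurable A ->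
    Q (Y @^-1` B `&` Z @^-1` A) = \int[mu]_(x in B) K x A)%E ->
  measurable_fun [set: T1] g -> (forall x, 0 <= g x) ->
  measurable_fun [set: T2] h -> (forall y, 0 <= h y)%E ->
  (\int[Q]_w ((g (Y w))%:E * h (Z w)) =
   \int[mu]_x ((g x)%:E * \int[K x]_y h y))%E.
Proof.
move=> mY mZ YZE mg g0 mh h0.
transitivity (\int[Q]_w ((g (Y w))%:E * \int[\d_(Z w)]_y h y))%E.
  by apply: eq_integral => w _; rewrite integral_dirac // diracT mul1e.
apply: eq_integral_mixture => //.
- exact: measurableT_comp.
- by move=> A mA; exact: measurable_dirac_comp.
- by move=> A mA; exact: measurable_kernel.
move=> A mA.
have Kfin x : K x A \is a fin_num.
  exact: kernel_finite_transition.
(* The roles are exchanged: the fixed set [A] now sits in the weights, while [g] is integrated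
   against Dirac masses, so that only sets [B] remain to be tested. *)
transitivity (\int[Q]_w ((\1_A (Z w))%:E * \int[\d_(Y w)]_x (g x)%:E))%E.
  apply: eq_integral => w _; rewrite integral_dirac //; last exact/measurable_EFinP.
  by rewrite diracT mul1e muleC.
transitivity (\int[mu]_x ((fine (K x A))%:E * \int[\d_x]_x0 (g x0)%:E))%E; last first.
  apply: eq_integral => x _; rewrite integral_dirac //; last exact/measurable_EFinP.
  by rewrite diracT mul1e muleC fineK.
apply: eq_integral_mixture => //.
- exact: measurableT_comp (measurable_indic _) mZ.
- by move=> B mB; exact: measurable_dirac_comp.
- by apply: measurableT_comp (measurable_kernel K A mA); exact: fine_measurable.
- by move=> B mB; exact: measurable_dirac_comp.
- exact/measurable_EFinP.
move=> B mB.
have mYB : measurable (Y @^-1` B) by rewrite -[_ @^-1` _]setTI; exact: mY.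
have mZA : measurable (Z @^-1` A) by rewrite -[_ @^-1` _]setTI; exact: mZ.
transitivity (\int[Q]_w (\1_(Y @^-1` B `&` Z @^-1` A) w)%:E)%E.
  apply: eq_integral => w _; rewrite /= diracE indicI /= EFinM muleC.
  by rewrite !indicE.
rewrite integral_indic //; last exact: measurableI.
rewrite setIT YZE // integral_mkcond epatch_indic; apply: eq_integral => x _.
by rewrite /= fineK // diracE indicE.
Qed.

(** * One-dimensional marginals of a coupling *)

Lemma has_law_marginal {R : realType} {d dW : measure_display}
    {T : measurableType d} {W : measurableType dW} (P : R -> R.-pker T ~> T)
    (mu : {measure set T -> \bar R}) (Q : probability W R) (Z : R -> W -> T)
    (t : R) (A : set T) :
  has_law P mu Q Z -> 0 <= t -> measurable A ->
  Q (Z t @^-1` A) = (\int[mu]_x P t x A)%E.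
Proof.
move=> [_ lawZ] t0 mA.
have := lawZ [:: (t, A)]; rewrite /= add0r setIT => ->; last first.
  by move=> hA; rewrite inE => /eqP ->.
by apply: eq_integral => x _; rewrite integral_cst // mul1e.
Qed.

Lemma has_law_dirac_marginal {R : realType} {d dW : measure_display}
    {T : measurableType d} {W : measurableType dW} (P : R -> R.-pker T ~> T)
    (x : T) (Q : probability W R) (Z : R -> W -> T) (t : R) (A : set T) :
  has_law P \d_x Q Z -> 0 <= t -> measurable A ->
  Q (Z t @^-1` A) = P t x A.
Proof.
move=> lawZ t0 mA; rewrite (has_law_marginal _ _ _ _ _ _ lawZ) //.
by rewrite integral_dirac ?diracT ?mul1e //; exact: measurable_kernel.
Qed.

(** * The stationary two-sided process and duality *)

Lemma markov_two_sided_joint {R : realType} {d dW : measure_display}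
    {T : measurableType d} {W : measurableType dW} (P : R -> R.-pker T ~> T)
    (mu : {measure set T -> \bar R}) (Q : probability W R) (Y : R -> W -> T)
    (s t : R) (B A : set T) :
  markov_two_sided P Q Y -> 0 <= t ->
  (forall A, measurable A -> Q (Y s @^-1` A) = mu A) ->
  measurable B -> measurable A ->
  Q (Y s @^-1` B `&` Y (s + t) @^-1` A) = (\int[mu]_(x in B) P t x A)%E.
Proof.
move=> [mY markovY] t0 Ys mB mA; rewrite markovY //; last first.
  by apply: sub_sigma_algebra; exists s, B.
transitivity (\int[pushforward Q (Y s)]_(x in B) P t x A)%E.
  rewrite (ge0_integral_pushforward (mY s)) //.
  exact: measurable_funTS (measurable_kernel (P t) A mA).
by apply: eq_measure_integral => E mE _; exact: Ys.
Qed.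

(** Both sides are the expectation of [g (Y 0) * h (Y t)] for the stationary process: conditioning
    on [Y 0] produces [P t], and conditioning on [Y t] with time reversed produces [Ps t]. *)
Lemma dual_transition_adjoint {R : realType} {d : measure_display}
    {T : measurableType d} (P Ps : R -> R.-pker T ~> T) (pi : probability T R)
    (t : R) (g h : T -> R) :
  dual_transition_function P pi Ps -> 0 <= t ->
  measurable_fun [set: T] g -> (forall x, 0 <= g x) ->
  measurable_fun [set: T] h -> (forall x, 0 <= h x) ->
  (\int[pi]_x ((g x)%:E * \int[P t x]_y (h y)%:E) =
   \int[pi]_y ((h y)%:E * \int[Ps t y]_x (g x)%:E))%E.
Proof.
move=> [_ [dW [W [Q [Y [statY markY Y0 markYs]]]]]] t0 mg g0 mh h0.
have [mY _] := markY.
have Yt A : measurable A -> Q (Y t @^-1` A) = pi A.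
  move=> mA; rewrite -Y0 //.
  have := statY 1%N (fun=> 0) (fun=> A) t (fun=> mA).
  rewrite add0r; congr (Q _ = Q _); apply/seteqP; split => w //=.
  - exact: (fun f => f ord0).
  - exact: (fun f => f ord0).
rewrite -(ge0_integral_joint_law Q pi (P t) (Y 0) (Y t)) //; last 2 first.
- move=> B A mB mA; rewrite -[in Y t](add0r t).
  exact: markov_two_sided_joint markY _ _ _ _.
- exact/measurable_EFinP.
rewrite -(ge0_integral_joint_law Q pi (Ps t) (Y t) (Y 0)) //; last 2 first.
- move=> B A mB mA.
  (* The reversed process is at [Y t] at its time [- t] and reaches [Y 0] after a delay [t]. *)
  have := @markov_two_sided_joint _ _ _ _ _ Ps pi Q _ (- t) t B A markYs t0.
  by rewrite addNr oppr0 opprK; apply.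
- exact/measurable_EFinP.
by apply: eq_integral => w _; rewrite muleC.
Qed.

(** * Moments of the weight under an exponential coupling *)

(** Where the coordinates agree, so do their weights; elsewhere either weight is below the coupling
    cost [J]. Hence the moment from [x] and the stationary moment differ by at most [C * phi x]. For
    the dual process this controls the growth of the weight uniformly in time. *)
Lemma exponential_coupling_moment {R : realType} {d : measure_display}
    {T : measurableType d} (P : R -> R.-pker T ~> T) (phi : T -> R) :
  transition_function P -> exponential_coupling P phi ->
  measurable_fun [set: T] phi -> (forall x, 1 <= phi x) ->
  exists2 C : R, 0 < C & forall t x, 0 <= t ->
    (\int[P t x]_y (phi y)%:E <= (C * phi x)%:E)%E.
Proof.
move=> [P0 _] [pi [beta [inv_pi beta0 [C C0 coup]]]] mphi phi1.
(* One [C] pays for passing from [Z1] to [Z2] at time [t]; the other [C + 1] bounds the stationary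
   moment by the coupling at time 0. *)
exists (2 * C + 1); first by rewrite ltr_wpDl // mulr_ge0 // ltW.
move=> t x t0.
have phi0 y : 0 <= phi y by rewrite (le_trans ler01).
have [dW [W [Q [Z1 [Z2 [[law1 law2] ZE]]]]]] := coup x.
have [mZ1 _] := law1; have [mZ2 _] := law2.
have law_phi1 s : 0 <= s ->
    (\int[Q]_w (phi (Z1 s w))%:E = \int[P s x]_y (phi y)%:E)%E.
  move=> s0; apply: ge0_integral_law => //; first exact: mZ1.
  - by move=> A mA; exact: has_law_dirac_marginal law1 _ _.
  - exact/measurable_EFinP.
have law_phi2 s : 0 <= s ->
    (\int[Q]_w (phi (Z2 s w))%:E = \int[pi]_y (phi y)%:E)%E.
  move=> s0; apply: ge0_integral_law => //; first exact: mZ2.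
  - move=> A mA; apply: etrans (has_law_marginal _ _ _ _ _ _ law2 s0 mA) _.
    exact: inv_pi.
  - exact/measurable_EFinP.
pose D s := [set w | Z1 s w <> Z2 s w].
have mphiZ1 s : 0 <= s -> measurable_fun [set: W] (phi \o Z1 s).
  by move=> s0; exact: measurableT_comp mphi (mZ1 s s0).
have mphiZ2 s : 0 <= s -> measurable_fun [set: W] (phi \o Z2 s).
  by move=> s0; exact: measurableT_comp mphi (mZ2 s s0).
pose J s w := (phi (Z1 s w) + phi (Z2 s w)) * \1_(D s) w.
have mJ s : 0 <= s -> measurable_fun [set: W] (J s).
  move=> s0; apply: measurable_funM.
    by apply: measurable_funD; [exact: mphiZ1|exact: mphiZ2].
  by have [mD _] := ZE s s0; exact: measurable_indic.
have J0 s w : 0 <= J s w by rewrite mulr_ge0 // addr_ge0.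
have JC s : 0 <= s -> (\int[Q]_w (J s w)%:E <= (C * phi x)%:E)%E.
  move=> s0; have [_] := ZE s s0; rewrite expectation.unlock => /le_trans; apply.
  rewrite lee_fin ler_wpM2r // ler_piMr ?(ltW C0) //.
  by rewrite -expR0 ler_expR oppr_le0 mulr_ge0 // ltW.
have le12 s w : phi (Z1 s w) <= J s w + phi (Z2 s w).
  rewrite /J /D indicE; have [e|ne] := pselect (Z1 s w = Z2 s w).
    by rewrite memNset ?mulr0 ?add0r ?e //= => /(_ e).
  by rewrite mem_set //= mulr1 -addrA lerDl addr_ge0.
have le21 s w : phi (Z2 s w) <= J s w + phi (Z1 s w).
  rewrite /J /D indicE; have [e|ne] := pselect (Z1 s w = Z2 s w).
    by rewrite memNset ?mulr0 ?add0r ?e //= => /(_ e).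
  by rewrite mem_set //= mulr1 -addrA addrCA lerDl addr_ge0.
have int_le (u v : W -> R) s : 0 <= s ->
    measurable_fun [set: W] u -> (forall w, 0 <= u w) ->
    measurable_fun [set: W] v -> (forall w, 0 <= v w) ->
    (forall w, u w <= J s w + v w) ->
    (\int[Q]_w (u w)%:E <= (C * phi x)%:E + \int[Q]_w (v w)%:E)%E.
  move=> s0 mu u0 mv v0 uv.
  have mJE := mJ s s0.
  apply: (@le_trans _ _ (\int[Q]_w ((J s w)%:E + (v w)%:E))%E).
    apply: ge0_le_integral => //.
    - by move=> w _; rewrite lee_fin.
    - exact/measurable_EFinP.
    - by apply: emeasurable_funD; exact/measurable_EFinP.
    - by move=> w _; rewrite -EFinD lee_fin.
  rewrite ge0_integralD //; last 4 first.
  - by move=> w _; rewrite lee_fin.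
  - exact/measurable_EFinP.
  - by move=> w _; rewrite lee_fin.
  - exact/measurable_EFinP.
  by rewrite leeD2r // JC.
(* The coupling at time 0, where [Z1 0] has law [\d_x], bounds the integral of
   [phi] against the invariant measure. *)
have pi_phi : (\int[pi]_y (phi y)%:E <= ((C + 1) * phi x)%:E)%E.
  rewrite -(law_phi2 0) //.
  have := int_le (phi \o Z2 0) (phi \o Z1 0) 0 (lexx 0) (mphiZ2 0 (lexx 0))
    (fun w => phi0 _) (mphiZ1 0 (lexx 0)) (fun w => phi0 _) (le21 0).
  move=> /le_trans; apply.
  rewrite /comp law_phi1 // mulrDl mul1r EFinD leeD2l //.
  rewrite (eq_measure_integral \d_x) => [|A mA _]; last exact: P0.
  by rewrite integral_dirac ?diracT ?mul1e //; exact/measurable_EFinP.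
rewrite -law_phi1 //.
have := int_le (phi \o Z1 t) (phi \o Z2 t) t t0 (mphiZ1 t t0)
  (fun w => phi0 _) (mphiZ2 t t0) (fun w => phi0 _) (le12 t).
move=> /le_trans; apply.
rewrite /comp law_phi2 //.
have -> : (2 * C + 1) * phi x = C * phi x + (C + 1) * phi x.
  by ring.
by rewrite EFinD leeD2l.
Qed.

(** * A Hoelder-type inequality on the coupling event *)

(** If [w > 1], the exponent [p >= 2] gives [w ^+ 2 <= x * y], hence [w <= x + y]; otherwise the
    constant 1 suffices. *)
Lemma le_addr_of_powR_le_mul {R : realType} (p w x y : R) :
  2 <= p -> 0 <= w -> 0 <= x -> 0 <= y -> w `^ p <= x * y ->
  w <= 1 + x + y.
Proof.
move=> p2 w0 x0 y0 wxy; have [w1|w1] := leP w 1.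
  by rewrite -addrA ler_wpDr // addr_ge0.
have w2 : w ^+ 2 <= x * y.
  apply: le_trans wxy; rewrite -powR_mulrn //.
  by apply: ler_powR => //; exact: ltW.
rewrite expr2 in w2; nra.
Qed.

Lemma measurable_powR_quot {R : realType} {d : measure_display}
    {T : measurableType d} (u phi : T -> R) (p : R) :
  measurable_fun [set: T] u -> measurable_fun [set: T] phi ->
  (forall x, 1 <= phi x) ->
  measurable_fun [set: T] (fun x => u x `^ p / phi x).
Proof.
move=> mu mphi phi1; apply: measurable_funM.
  exact: measurableT_comp (measurable_powR p) mu.
have -> : (fun x => (phi x)^-1) = (fun x => phi x `^ (-1)).
  by apply/funext => x; rewrite powR_inv1 // (le_trans ler01).
exact: measurableT_comp (measurable_powR _) mphi.
Qed.

Lemma integral_weighted_bound {R : realType} {dW : measure_display}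
    {W : measurableType dW} (Q : probability W R) (D : set W)
    (U1 U2 V1 V2 : W -> R) (p A B : R) :
  2 <= p -> 0 < A -> 0 < B -> measurable D ->
  measurable_fun [set: W] U1 -> (forall w, 0 <= U1 w) ->
  measurable_fun [set: W] U2 -> (forall w, 0 <= U2 w) ->
  measurable_fun [set: W] V1 -> (forall w, 1 <= V1 w) ->
  measurable_fun [set: W] V2 -> (forall w, 1 <= V2 w) ->
  (\int[Q]_w (U1 w `^ p / V1 w + U2 w `^ p / V2 w)%:E <= A%:E)%E ->
  (\int[Q]_w ((V1 w + V2 w) * \1_D w)%:E <= B%:E)%E ->
  (\int[Q]_w ((U1 w + U2 w) * \1_D w)%:E <= (4 * (A * B) `^ p^-1)%:E)%E.
Proof.
move=> p2 A0 B0 mD mU1 U10 mU2 U20 mV1 V11 mV2 V21 hA hB.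
have p0 : 0 < p by lra.
(* With [w = U / k], [w ^ p] is the product of [U ^ p / (V A)] and [V / B], so
   [w] is at most 1 plus their sum; integrating gives a three-factor Hoelder
   inequality up to the constant 4. *)
pose k := (A * B) `^ p^-1.
have AB0 : 0 < A * B by rewrite mulr_gt0.
have k0 : 0 < k by rewrite powR_gt0.
have kp : k `^ p = A * B by rewrite -powRrM mulVf ?gt_eqF // powRr1 // ltW.
pose S w := U1 w `^ p / V1 w + U2 w `^ p / V2 w.
pose G w := (V1 w + V2 w) * \1_D w.
have V10 w : 0 < V1 w by exact: lt_le_trans (V11 w).
have V20 w : 0 < V2 w by exact: lt_le_trans (V21 w).
have S0 w : 0 <= S w by rewrite addr_ge0 // divr_ge0 ?powR_ge0 // ltW.
have G0 w : 0 <= G w by rewrite mulr_ge0 // addr_ge0 // ltW.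
have mS : measurable_fun [set: W] S.
  by apply: measurable_funD; exact: measurable_powR_quot.
have mG : measurable_fun [set: W] G.
  by apply: measurable_funM; [exact: measurable_funD|exact: measurable_indic].
have pointwise (U V : R) : 0 <= U -> 0 < V ->
    U <= k * (1 + (U `^ p / V) / A + V / B).
  move=> U0 V0; rewrite mulrC -ler_pdivrMr //.
  apply: (le_addr_of_powR_le_mul p) => //.
  - by rewrite divr_ge0 // ltW.
  - by rewrite !divr_ge0 ?powR_ge0 // ltW.
  - by rewrite divr_ge0 // ltW.
  rewrite powRM // ?invr_ge0 ?(ltW k0) //.
  rewrite -(powR_inv1 (ltW k0)) -powRrM mulN1r powRN kp.
  rewrite le_eqVlt; apply/orP; left; apply/eqP.
  by field; rewrite !gt_eqF.
(* On [D] the two pointwise bounds add up. Off [D] the left side vanishes and the right side is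
   nonnegative, so only [G] has to carry the indicator. *)
apply: (@le_trans _ _
    (\int[Q]_w (2 * k + (k / A) * S w + (k / B) * G w)%:E)%E).
  apply: ge0_le_integral => //.
  - by move=> w _; rewrite lee_fin mulr_ge0 // addr_ge0.
  - by apply/measurable_EFinP/measurable_funM; [exact: measurable_funD|exact: measurable_indic].
  - apply/measurable_EFinP; apply: measurable_funD; last exact: measurable_funM.
    by apply: measurable_funD => //; exact: measurable_funM.
  move=> w _; rewrite lee_fin /G indicE.
  have [wD|wD] := boolP (w \in D).
    have := pointwise _ _ (U10 w) (V10 w); have := pointwise _ _ (U20 w) (V20 w).
    rewrite /S; set X1 := _ `^ _ / _; set X2 := _ `^ _ / _ => h2 h1.
    rewrite /= !mulr1; apply: le_trans (lerD h1 h2) _.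
    by rewrite le_eqVlt; apply/orP; left; apply/eqP; ring.
  rewrite !mulr0 addr0 addr_ge0 //; first by rewrite mulr_ge0 // ltW.
  by rewrite mulr_ge0 // divr_ge0 // ltW.
under eq_integral do rewrite !EFinD !(EFinM (_ / _)).
have kA0 : 0 <= k / A by rewrite divr_ge0 // ltW.
have kB0 : 0 <= k / B by rewrite divr_ge0 // ltW.
have mkS : measurable_fun [set: W] (fun w => (k / A)%:E * (S w)%:E)%E.
  by apply: measurable_funeM; exact/measurable_EFinP.
have mkG : measurable_fun [set: W] (fun w => (k / B)%:E * (G w)%:E)%E.
  by apply: measurable_funeM; exact/measurable_EFinP.
rewrite ge0_integralD //; last 3 first.
- by move=> w _; rewrite adde_ge0 ?mule_ge0 ?lee_fin // mulr_ge0 // ltW.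
- exact: emeasurable_funD.
- by move=> w _; rewrite mule_ge0 ?lee_fin.
rewrite ge0_integralD //; last 2 first.
- by move=> w _; rewrite lee_fin mulr_ge0 // ltW.
- by move=> w _; rewrite mule_ge0 ?lee_fin.
rewrite integral_cst // [X in (_ * X + _ + _)%E](@probability_setT _ _ _ Q) mule1.
have integralZ (a : R) (f : W -> R) : 0 <= a -> measurable_fun [set: W] f ->
    (forall w, 0 <= f w) ->
    (\int[Q]_w (a%:E * (f w)%:E) = a%:E * \int[Q]_w (f w)%:E)%E.
  move=> a0 mf f0; rewrite ge0_integralZl // ?lee_fin //.
  - exact/measurable_EFinP.
  - by move=> w _; rewrite lee_fin.
rewrite !integralZ //.
(* The bounds [A] and [B] cancel the normalisations, leaving [2 k + k + k]. *)
have -> : 4 * (A * B) `^ p^-1 = 2 * k + (k / A) * A + (k / B) * B.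
  by rewrite -/k; field; rewrite !gt_eqF.
rewrite !EFinD !(EFinM (_ / _)).
by apply: leeD; [apply: leeD => //|]; apply: lee_wpmul2l; rewrite ?lee_fin.
Qed.

(** * Signed integrals under a coupling *)

Lemma integrable_law {R : realType} {dW dT : measure_display}
    {W : measurableType dW} {T : measurableType dT}
    (Q : {measure set W -> \bar R}) (mu : {measure set T -> \bar R})
    (Z : W -> T) (g : T -> R) :
  measurable_fun [set: W] Z ->
  (forall A, measurable A -> Q (Z @^-1` A) = mu A) ->
  measurable_fun [set: T] g ->
  Q.-integrable [set: W] (EFin \o (g \o Z)) <->
  mu.-integrable [set: T] (EFin \o g).
Proof.
move=> mZ ZE mg.
have E : (\int[Q]_w `|(g (Z w))%:E| = \int[mu]_y `|(g y)%:E|)%E.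
  apply: (ge0_integral_law Q mu Z (fun y => `|(g y)%:E|%E)) => //.
  by apply: measurableT_comp => //; exact/measurable_EFinP.
split=> /integrableP [_ I]; apply/integrableP; split.
- exact/measurable_EFinP.
- by rewrite -E.
- by apply/measurable_EFinP; exact: measurableT_comp.
- by rewrite E.
Qed.

Lemma Rintegral_law {R : realType} {dW dT : measure_display}
    {W : measurableType dW} {T : measurableType dT}
    (Q : {measure set W -> \bar R}) (mu : {measure set T -> \bar R})
    (Z : W -> T) (g : T -> R) :
  measurable_fun [set: W] Z ->
  (forall A, measurable A -> Q (Z @^-1` A) = mu A) ->
  measurable_fun [set: T] g ->
  Q.-integrable [set: W] (EFin \o (g \o Z)) ->
  \int[Q]_w g (Z w) = \int[mu]_y g y.
Proof.
move=> mZ ZE mg ig; congr fine.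
transitivity (\int[pushforward Q Z]_y (g y)%:E)%E.
  by rewrite (integral_pushforward mZ) //; exact/measurable_EFinP.
by apply: eq_measure_integral => A mA _; exact: ZE.
Qed.

(** Since [g] has mean zero under [nu], its integral under [mu] is the expectation of
    [g (Z1 w) - g (Z2 w)]. This vanishes where the coordinates agree and is dominated by
    [u (Z1 w) + u (Z2 w)] elsewhere. *)
Lemma coupling_Rintegral_le {R : realType} {dW dT : measure_display}
    {W : measurableType dW} {T : measurableType dT} (Q : probability W R)
    (mu nu : {measure set T -> \bar R}) (Z1 Z2 : W -> T) (g u : T -> R) (b : R) :
  measurable_fun [set: W] Z1 -> measurable_fun [set: W] Z2 ->
  (forall A, measurable A -> Q (Z1 @^-1` A) = mu A) ->
  (forall A, measurable A -> Q (Z2 @^-1` A) = nu A) ->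
  measurable [set w | Z1 w <> Z2 w] ->
  measurable_fun [set: T] g -> measurable_fun [set: T] u ->
  (forall y, `|g y| <= u y) ->
  nu.-integrable [set: T] (EFin \o g) -> \int[nu]_y g y = 0 ->
  (\int[Q]_w ((u (Z1 w) + u (Z2 w)) *
     \1_[set v | Z1 v <> Z2 v] w)%:E <= b%:E)%E ->
  `|\int[mu]_y g y| <= b.
Proof.
move=> mZ1 mZ2 Z1E Z2E mD mg mu_ gu ig g0 Jb.
set D := [set w | _] in mD Jb.
pose J w := (u (Z1 w) + u (Z2 w)) * \1_D w.
have u0 y : 0 <= u y by exact: le_trans (gu y).
have J0 w : 0 <= J w by rewrite mulr_ge0 // addr_ge0.
have mJ : measurable_fun [set: W] J.
  apply: measurable_funM; last exact: measurable_indic.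
  by apply: measurable_funD; exact: measurableT_comp.
have iJ : Q.-integrable [set: W] (EFin \o J).
  apply/integrableP; split; first exact/measurable_EFinP.
  under eq_integral do rewrite /comp abse_EFin ger0_norm //.
  exact: le_lt_trans Jb (ltry _).
have diffJ w : `|g (Z1 w) - g (Z2 w)| <= J w.
  rewrite /J indicE; have [e|ne] := pselect (Z1 w = Z2 w).
    by rewrite memNset ?e ?subrr ?normr0 ?mulr0 //= => /(_ e).
  by rewrite mem_set // mulr1 (le_trans (ler_normB _ _)) // lerD.
have mgZ1 : measurable_fun [set: W] (g \o Z1) by exact: measurableT_comp.
have mgZ2 : measurable_fun [set: W] (g \o Z2) by exact: measurableT_comp.
have igZ2 : Q.-integrable [set: W] (EFin \o (g \o Z2)).
  exact/(integrable_law Q nu Z2).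
pose f w := g (Z1 w) - g (Z2 w).
have idiff : Q.-integrable [set: W] (EFin \o f).
  apply: le_integrable iJ => //.
    by apply/measurable_EFinP; exact: measurable_funB.
  by move=> w _; rewrite /= lee_fin (ger0_norm (J0 w)); exact: diffJ.
(* Integrability of [g] under [mu] is deduced from that of the difference and of [g \o Z2], so the
   integral being bounded is not a default value. *)
have igZ1 : Q.-integrable [set: W] (EFin \o (g \o Z1)).
  have -> : EFin \o (g \o Z1) = ((EFin \o f) \+ (EFin \o (g \o Z2)))%E.
    by apply/funext => w; rewrite /= /f -EFinD subrK.
  exact: integrableD.
rewrite -(Rintegral_law Q mu Z1) // -[X in `|X|]subr0 -g0.
rewrite -(Rintegral_law Q nu Z2) // -RintegralB //.
apply: (le_trans (le_normr_Rintegral measurableT idiff)).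
rewrite -lee_fin; apply: le_trans Jb; rewrite /Rintegral fineK; last first.
  by apply: integrable_fin_num => //; exact: integrable_norm idiff.
apply: ge0_le_integral => //.
- by apply/measurable_EFinP/measurableT_comp => //; exact: measurable_funB.
- exact/measurable_EFinP.
- by move=> w _; rewrite lee_fin; exact: diffJ.
Qed.

(** * Constants from the comparability of two weights *)

Lemma asymp_comparable_bounds {R : realType} {d : measure_display}
    {T : measurableType d} (phi psi : T -> R) :
  (forall x, 1 <= phi x) -> (forall x, 1 <= psi x) ->
  asymp_comparable phi psi ->
  exists a b : R, [/\ 0 < a, 0 < b, forall x, phi x <= a * psi x &
    forall x, psi x <= b * phi x].
Proof.
move=> phi1 psi1 [inf0 supoo].
have psi0 x : 0 < psi x by exact: lt_le_trans (psi1 x).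
have [a a0 ha] : exists2 a : R, 0 < a & forall x, phi x <= a * psi x.
  have ub x := @ereal_sup_ubound R _ _ (imageT (fun x => (phi x / psi x)%:E) x).
  move: ub supoo; case: (ereal_sup _) => [r||] // ub _.
    (* The maximum with 1 makes the constant visibly positive. *)
    exists (Num.max r 1); first by rewrite lt_max ltr01 orbT.
    move=> x; rewrite -ler_pdivrMr //.
    by have := ub x; rewrite lee_fin => /le_trans; apply; rewrite le_max lexx.
  (* The supremum is [-oo] only over an empty space, where any constant works; the same holds for an
     infimum [+oo] below. *)
  by exists 1 => // x; have := ub x; rewrite leeNy_eq.
have [b b0 hb] : exists2 b : R, 0 < b & forall x, psi x <= b * phi x.
  have lb x := @ereal_inf_lbound R _ _ (imageT (fun x => (phi x / psi x)%:E) x).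
  move: lb inf0; case: (ereal_inf _) => [r||] // lb; last first.
    by exists 1 => // x; have := lb x; rewrite leye_eq.
  rewrite lte_fin => r0; exists r^-1; first by rewrite invr_gt0.
  move=> x; rewrite mulrC ler_pdivlMr // mulrC -ler_pdivlMr //.
  by have := lb x; rewrite lee_fin.
by exists a, b.
Qed.

(** * Complex moduli and measurability of the semigroup *)

Lemma Re_le_normc {R : rcfType} (z : R[i]) : `|complex.Re z| <= Normc.normc z.
Proof.
by case: z => a b /=; rewrite -sqrtr_sqr ler_wsqrtr // lerDl sqr_ge0.
Qed.

Lemma Im_le_normc {R : rcfType} (z : R[i]) : `|complex.Im z| <= Normc.normc z.
Proof.
by case: z => a b /=; rewrite -sqrtr_sqr ler_wsqrtr // lerDr sqr_ge0.
Qed.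

Lemma normc_ge0 {R : rcfType} (z : R[i]) : 0 <= Normc.normc z.
Proof. by case: z => a b; exact: sqrtr_ge0. Qed.

Lemma normc_le_ReIm {R : rcfType} (z : R[i]) :
  Normc.normc z <= `|complex.Re z| + `|complex.Im z|.
Proof.
case: z => a b /=; rewrite -[leRHS]ger0_norm ?addr_ge0 // -(sqrtr_sqr (`|a| + `|b|)).
rewrite ler_wsqrtr // sqrrD !real_normK ?num_real // -addrA lerD2l.
by rewrite lerDr mulrn_wge0 // mulr_ge0.
Qed.

Lemma measurable_normc {R : realType} {d : measure_display}
    {T : measurableType d} (f : T -> R[i]) :
  measurable_fun [set: T] (fun x => complex.Re (f x)) ->
  measurable_fun [set: T] (fun x => complex.Im (f x)) ->
  measurable_fun [set: T] (fun x => Normc.normc (f x)).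
Proof.
move=> mRe mIm.
have -> : (fun x => Normc.normc (f x)) =
    (fun x => Num.sqrt (complex.Re (f x) ^+ 2 + complex.Im (f x) ^+ 2)).
  by apply/funext => x; case: (f x).
apply: measurableT_comp.
  by apply: continuous_measurable_fun; exact: sqrt_continuous.
by apply: measurable_funD; exact: measurable_funX.
Qed.

(** The integrals of the positive and negative parts are measurable in [x], and so is [fine] of
    their difference; this includes the points where [g] is not integrable. *)
Lemma measurable_Rintegral_kernel {R : realType} {d1 d2 : measure_display}
    {S : measurableType d1} {T : measurableType d2} (K : R.-pker S ~> T)
    (g : T -> R) :
  measurable_fun [set: T] g ->
  measurable_fun [set: S] (fun x => \int[K x]_y g y).
Proof.
move=> mg; apply: measurableT_comp; first exact: fine_measurable.
under eq_fun do rewrite integralE.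
apply: emeasurable_funB.
- apply: measurable_fun_integral_kernel => //.
  + by move=> U mU; exact: measurable_kernel.
  + by apply: measurable_funepos; exact/measurable_EFinP.
- apply: measurable_fun_integral_kernel => //.
  + by move=> U mU; exact: measurable_kernel.
  + by apply: measurable_funeneg; exact/measurable_EFinP.
Qed.

Lemma measurable_semigroup {R : realType} {d : measure_display}
    {T : measurableType d} (P : R -> R.-pker T ~> T) (t : R) (f : T -> R[i]) :
  measurable_fun [set: T] (fun x => complex.Re (f x)) ->
  measurable_fun [set: T] (fun x => complex.Im (f x)) ->
  measurable_fun [set: T] (fun x => Normc.normc (semigroup P t f x)).
Proof.
by move=> mRe mIm; apply: measurable_normc; exact: measurable_Rintegral_kernel.
Qed.

Lemma cLnormE {R : realType} {d : measure_display} {T : measurableType d}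
    (mu : {measure set T -> \bar R}) (p : R) (f : T -> R[i]) :
  cLnorm mu p f = ((\int[mu]_x (Normc.normc (f x) `^ p)%:E) `^ p^-1)%E.
Proof.
rewrite /cLnorm unlock; congr (_ `^ _)%E; apply: eq_integral => x _ /=.
by rewrite ger0_norm ?normc_ge0.
Qed.

(** * Pointwise estimate of the semigroup on mean-zero functions *)

(** The weighted bound is applied to the modulus of [f] and to [phi] along both coordinates. The
    first coordinate contributes the integral under [P t x]; the second contributes at most [N],
    because [phi >= 1]. The strict inequality on [N] makes [A] positive. *)
Lemma semigroup_pointwise_bound {R : realType} {d dW : measure_display}
    {T : measurableType d} {W : measurableType dW} (P : R -> R.-pker T ~> T)
    (pi : probability T R) (phi : T -> R) (Q : probability W R)
    (Z1 Z2 : R -> W -> T) (t : R) (x : T) (f : T -> R[i]) (p B N : R) :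
  Defs.invariant P pi -> coupling P \d_x pi Q Z1 Z2 -> 0 <= t ->
  measurable [set w | Z1 t w <> Z2 t w] ->
  measurable_fun [set: T] phi -> (forall y, 1 <= phi y) ->
  (\int[Q]_w ((phi (Z1 t w) + phi (Z2 t w)) *
     \1_[set v | Z1 t v <> Z2 t v] w)%:E <= B%:E)%E ->
  0 < B -> 2 <= p -> cLp0 pi p f ->
  (\int[pi]_y (Normc.normc (f y) `^ p)%:E < N%:E)%E ->
  ((Normc.normc (semigroup P t f x) `^ p)%:E <=
   (8 `^ p * B)%:E *
     (\int[P t x]_y (Normc.normc (f y) `^ p / phi y)%:E + N%:E))%E.
Proof.
move=> inv_pi [law1 law2] t0 mD mphi phi1 hB B0 p2 [[mRe mIm _] f0] hN.
pose u y := Normc.normc (f y).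
have u0 y : 0 <= u y by exact: normc_ge0.
have phi0 y : 0 < phi y by exact: lt_le_trans (phi1 y).
have meas_u : measurable_fun [set: T] u by exact: measurable_normc.
pose h y := u y `^ p / phi y.
have h0 y : 0 <= h y by rewrite divr_ge0 ?powR_ge0 // ltW.
have mh : measurable_fun [set: T] h by exact: measurable_powR_quot.
have mup : measurable_fun [set: T] (fun y => u y `^ p).
  exact: measurableT_comp (measurable_powR p) meas_u.
have up0 : (0 <= \int[pi]_y (u y `^ p)%:E)%E.
  by apply: integral_ge0 => y _; rewrite lee_fin powR_ge0.
have N0 : 0 < N by rewrite -lte_fin (le_lt_trans up0).
have Ph0 : (0 <= \int[P t x]_y (h y)%:E)%E.
  by apply: integral_ge0 => y _; rewrite lee_fin.
have c0 : 0 < 8 `^ p * B by rewrite mulr_gt0 // powR_gt0.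
(* An infinite integral makes the right-hand side infinite; otherwise the claim is one about real
   numbers. *)
have [Phoo|Phfin] := eqVneq (\int[P t x]_y (h y)%:E)%E +oo%E.
  by rewrite Phoo addye // mulry gtr0_sg // mul1e leey.
have {Phfin}Phfin : (\int[P t x]_y (h y)%:E)%E \is a fin_num.
  by rewrite ge0_fin_numE // lt_neqAle Phfin leey.
pose A := fine (\int[P t x]_y (h y)%:E)%E + N.
have A0 : 0 < A by rewrite ltr_wpDl // fine_ge0.
have AE : (\int[P t x]_y (h y)%:E + N%:E = A%:E)%E by rewrite EFinD fineK.
rewrite AE -EFinM lee_fin.
have [mZ1 _] := law1; have [mZ2 _] := law2.
have Z1E E : measurable E -> Q (Z1 t @^-1` E) = P t x E.
  by move=> mE; exact: has_law_dirac_marginal law1 _ _.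
have Z2E E : measurable E -> Q (Z2 t @^-1` E) = pi E.
  move=> mE; apply: etrans (has_law_marginal _ _ _ _ _ _ law2 t0 mE) _.
  exact: inv_pi.
have muZ1 : measurable_fun [set: W] (u \o Z1 t).
  by apply: measurableT_comp => //; exact: mZ1.
have muZ2 : measurable_fun [set: W] (u \o Z2 t).
  by apply: measurableT_comp => //; exact: mZ2.
have mphiZ1 : measurable_fun [set: W] (phi \o Z1 t).
  by apply: measurableT_comp => //; exact: mZ1.
have mphiZ2 : measurable_fun [set: W] (phi \o Z2 t).
  by apply: measurableT_comp => //; exact: mZ2.
have mhE : measurable_fun [set: T] (EFin \o h) by exact/measurable_EFinP.
have intA : (\int[Q]_w (h (Z1 t w) + h (Z2 t w))%:E <= A%:E)%E.
  under eq_integral do rewrite EFinD.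
  have lawh1 : (\int[Q]_w (h (Z1 t w))%:E = \int[P t x]_y (h y)%:E)%E.
    by apply: (ge0_integral_law Q (P t x) (Z1 t) (EFin \o h)) => //; exact: mZ1.
  have lawh2 : (\int[Q]_w (h (Z2 t w))%:E = \int[pi]_y (h y)%:E)%E.
    by apply: (ge0_integral_law Q pi (Z2 t) (EFin \o h)) => //; exact: mZ2.
  rewrite ge0_integralD //; last 4 first.
  - by move=> w _; rewrite lee_fin.
  - by apply: (measurableT_comp mhE); exact: mZ1.
  - by move=> w _; rewrite lee_fin.
  - by apply: (measurableT_comp mhE); exact: mZ2.
  rewrite lawh1 lawh2 -AE leeD2l // (le_trans _ (ltW hN)) //.
  apply: ge0_le_integral => //.
  - by move=> y _; rewrite lee_fin.
  - exact/measurable_EFinP.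
  - by move=> y _; rewrite lee_fin ler_pdivrMr // ler_peMr // powR_ge0.
have := integral_weighted_bound Q _ (u \o Z1 t) (u \o Z2 t) (phi \o Z1 t)
  (phi \o Z2 t) p A B p2 A0 B0 mD muZ1 (fun w => u0 _) muZ2 (fun w => u0 _)
  mphiZ1 (fun w => phi1 _) mphiZ2 (fun w => phi1 _) intA hB.
set b := 4 * _ => Jb.
(* On a probability space L_p is contained in L_1: [u] is at most 1 plus its power of exponent
   [p]. *)
have int_u (g : T -> R) : measurable_fun [set: T] g -> (forall y, `|g y| <= u y) ->
    pi.-integrable [set: T] (EFin \o g).
  move=> mg gu; apply: (@le_integrable _ _ _ pi _ measurableT _
      (fun y => (1 + u y `^ p)%:E)).
  - exact/measurable_EFinP.
  - move=> y _; rewrite /= lee_fin (le_trans (gu y)) //.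
    rewrite ger0_norm ?addr_ge0 ?powR_ge0 //.
    have [u1|u1] := leP (u y) 1; first by rewrite ler_wpDr // powR_ge0.
    rewrite ler_wpDl // le1r_powR //; first exact: ltW.
    by rewrite (le_trans _ p2) // ler1n.
  - apply: (@integrableD _ _ _ pi _ measurableT (cst 1%:E) (fun y => (u y `^ p)%:E)).
      exact: finite_measure_integrable_cst.
    apply/integrableP; split; first exact/measurable_EFinP.
    under eq_integral do rewrite abse_EFin ger0_norm ?powR_ge0 //.
    exact: lt_trans hN (ltry _).
case: f0 => /= Re0 Im0.
have leb (g : T -> R) : measurable_fun [set: T] g -> (forall y, `|g y| <= u y) ->
    \int[pi]_y g y = 0 -> `|\int[P t x]_y g y| <= b.
  move=> mg gu g0.
  apply: (coupling_Rintegral_le Q (P t x) pi (Z1 t) (Z2 t) g u b) => //.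
  - exact: mZ1.
  - exact: mZ2.
  - exact: int_u.
(* The real and imaginary parts are each at most [b]; this 2 and the 4 in [b] make the 8 of the
   statement. *)
have Tfb : Normc.normc (semigroup P t f x) <= 2 * b.
  apply: (le_trans (normc_le_ReIm _)); rewrite mulr_natl mulr2n lerD // leb //.
  - by move=> y; exact: Re_le_normc.
  - by move=> y; exact: Im_le_normc.
apply: (@le_trans _ _ ((2 * b) `^ p)).
  apply: ge0_ler_powR => //; rewrite ?nnegrE ?normc_ge0 //.
    by rewrite (le_trans _ p2).
  by rewrite (le_trans _ Tfb) // normc_ge0.
have AB0 : 0 <= A * B by rewrite mulr_ge0 // ltW.
have -> : 2 * b = 8 * (A * B) `^ p^-1 by rewrite /b; ring.
have p0 : p != 0 by rewrite gt_eqF // (lt_le_trans _ p2).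
rewrite powRM ?powR_ge0 // -powRrM mulVf // powRr1 //.
by rewrite -mulrA (mulrC B).
Qed.

(** * Integration of the pointwise estimate and the resulting rate *)

Theorem theorem3p2 (R : realType) (d : measure_display)
    (T : borelMetricType d R)
    (hT : locally_compact [set: T])
    (P : R -> R.-pker T ~> T)
    (dW : measure_display) (W : measurableType dW) (F : R -> set (set W))
    (X : R -> W -> T) (Px : T -> probability W R)
    (hX : strong_markov_process P F X Px)
    (phi phis : T -> R)
    (mphi : measurable_fun [set: T] phi) (mphis : measurable_fun [set: T] phis)
    (phi_ge1 : forall x, 1 <= phi x) (phis_ge1 : forall x, 1 <= phis x)
    (pi : probability T R) (beta : R)
    (hphi : exponential_coupling_with P phi pi beta)
    (Ps : R -> R.-pker T ~> T)
    (hPs : dual_transition_function P pi Ps)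
    (hphis : exponential_coupling Ps phis)
    (hcmp : asymp_comparable phi phis)
    (phi_L1 : pi.-integrable [set: T] (EFin \o phi))
    (p : R) (hp : 2 <= p)
    (gamma : R) (hgamma : 0 < gamma) (hgamma_lt : gamma < beta / (2 * p - 1)) :
  GB P pi p gamma.
Proof.
have [inv_pi beta0 [C C0 coup]] := hphi.
have phi0 x : 0 < phi x by exact: lt_le_trans (phi_ge1 x).
have [a [b [a0 b0 phi_le phis_le]]] :=
  asymp_comparable_bounds phi phis phi_ge1 phis_ge1 hcmp.
have [transPs _] := hPs.
have [Cs Cs0 phis_moment] :=
  exponential_coupling_moment Ps phis transPs hphis mphis phis_ge1.
(* The factors come from [phi <= a phis], the dual moment bound for [phis], and [phis <= b phi]. *)
pose M := a * Cs * b.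
have M0 : 0 < M by rewrite !mulr_gt0.
have mphiE : measurable_fun [set: T] (EFin \o phi) by exact/measurable_EFinP.
have phi_moment t x : 0 <= t -> (\int[Ps t x]_y (phi y)%:E <= (M * phi x)%:E)%E.
  move=> t0; apply: (@le_trans _ _ (\int[Ps t x]_y (a%:E * (phis y)%:E))%E).
    apply: ge0_le_integral => //.
    - by move=> y _; rewrite lee_fin ltW.
    - by apply: measurable_funeM; exact/measurable_EFinP.
    - by move=> y _; rewrite -EFinM lee_fin.
  have phis0 y : 0 <= phis y by rewrite (le_trans ler01).
  rewrite ge0_integralZl //; last 3 first.
  - exact/measurable_EFinP.
  - by move=> y _; rewrite lee_fin.
  - by rewrite lee_fin ltW.
  apply: le_trans (lee_wpmul2l _ (phis_moment t x t0)) _.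
    by rewrite lee_fin ltW.
  rewrite -EFinM lee_fin /M -!mulrA ler_wpM2l ?(ltW a0) // ler_wpM2l ?(ltW Cs0) //.
have int_phi0 : (0 <= \int[pi]_x (phi x)%:E)%E.
  by apply: integral_ge0 => x _; rewrite lee_fin ltW.
have int_phi_fin : (\int[pi]_x (phi x)%:E)%E \is a fin_num.
  exact: integrable_fin_num phi_L1.
pose Phi := fine (\int[pi]_x (phi x)%:E)%E.
have Phi0 : 0 <= Phi by rewrite fine_ge0.
have p0 : 0 < p by rewrite (lt_le_trans _ hp).
pose K := 8 `^ p * C.
have K0 : 0 < K by rewrite mulr_gt0 // powR_gt0.
(* Since [p <= 2 p - 1] and [gamma > 0], the assumed bound on [gamma] gives this one. *)
have gamma_le : gamma * p <= beta.
  have q0 : 0 < 2 * p - 1 by lra.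
  have : gamma * (2 * p - 1) < beta by rewrite -ltr_pdivlMr.
  nra.
(* [K] comes from the pointwise estimate, [M] from the term handled by duality, and [Phi] from
   integrating the term [N * phi]. *)
exists ((K * (M + Phi)) `^ p^-1); first exact: powR_ge0.
move=> t f t0 hf.
have [[mRe mIm normf] _] := hf.
pose u y := Normc.normc (f y).
have meas_u : measurable_fun [set: T] u by exact: measurable_normc.
have mup : measurable_fun [set: T] (fun y => u y `^ p).
  exact: measurableT_comp (measurable_powR p) meas_u.
have up0 : (0 <= \int[pi]_y (u y `^ p)%:E)%E.
  by apply: integral_ge0 => y _; rewrite lee_fin powR_ge0.
have upfin : (\int[pi]_y (u y `^ p)%:E)%E \is a fin_num.
  rewrite ge0_fin_numE //; move: normf; rewrite cLnormE.
  by apply: lty_poweRy; rewrite invr_eq0 gt_eqF.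
pose N := fine (\int[pi]_y (u y `^ p)%:E)%E.
have NE : (\int[pi]_y (u y `^ p)%:E = N%:E)%E by rewrite fineK.
have N0 : 0 <= N by rewrite fine_ge0.
pose h y := u y `^ p / phi y.
have h0 y : 0 <= h y by rewrite divr_ge0 ?powR_ge0 // ltW.
have mh : measurable_fun [set: T] h by exact: measurable_powR_quot.
have mhE : measurable_fun [set: T] (EFin \o h) by exact/measurable_EFinP.
have mPh : measurable_fun [set: T] (fun x => \int[P t x]_y (h y)%:E)%E.
  apply: measurable_fun_integral_kernel => //.
  by move=> U mU; exact: measurable_kernel.
have Ph0 x : (0 <= \int[P t x]_y (h y)%:E)%E.
  by apply: integral_ge0 => y _; rewrite lee_fin.
pose E := expR (- (beta * t)).
have E0 : 0 < E by exact: expR_gt0.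
(* Duality moves the semigroup onto [phi], where [phi_moment] costs a factor [M]; the product of [h]
   and [phi] is then the power of the modulus of [f] integrating to [N]. *)
have adjoint : (\int[pi]_x ((phi x)%:E * \int[P t x]_y (h y)%:E) <= (M * N)%:E)%E.
  rewrite (dual_transition_adjoint _ _ _ _ _ _ hPs) //; last by move=> x; exact: ltW.
  rewrite EFinM -NE -ge0_integralZl //; last 3 first.
  - exact/measurable_EFinP.
  - by move=> y _; rewrite lee_fin powR_ge0.
  - by rewrite lee_fin ltW.
  apply: ge0_le_integral => //.
  - move=> y _; rewrite mule_ge0 ?lee_fin //.
    by apply: integral_ge0 => z _; rewrite lee_fin ltW.
  - apply: emeasurable_funM => //; apply: measurable_fun_integral_kernel => //.
    + by move=> U mU; exact: measurable_kernel.
    + by move=> y; rewrite lee_fin ltW.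
  - by apply: measurable_funeM; exact/measurable_EFinP.
  - move=> y _; apply: le_trans (lee_wpmul2l _ (phi_moment t y t0)) _.
      by rewrite lee_fin.
    rewrite -!EFinM lee_fin /h le_eqVlt; apply/orP; left; apply/eqP.
    by field; rewrite gt_eqF.
have int_bound : (\int[pi]_x (Normc.normc (semigroup P t f x) `^ p)%:E <=
    (K * E * (M + Phi) * N)%:E)%E.
  have KE0 : 0 < K * E by rewrite mulr_gt0.
  (* [delta] keeps the normalising constant of [semigroup_pointwise_bound]
     positive when [f] vanishes almost everywhere. *)
  suff bound delta : 0 < delta ->
      (\int[pi]_x (Normc.normc (semigroup P t f x) `^ p)%:E <=
       (K * E)%:E * ((M * N)%:E + (N + delta)%:E * Phi%:E))%E.
    apply/lee_addgt0Pr => e e0.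
    (* With this [delta] the excess is [e * Phi / (Phi + 1)], at most [e]; the added 1 keeps the
       denominator positive knowing only [0 <= Phi]. *)
    have d0 : 0 < e / (K * E * (Phi + 1)).
      by rewrite divr_gt0 // mulr_gt0 // ltr_wpDl.
    apply: le_trans (bound _ d0) _.
    rewrite -(EFinM (N + _)) -EFinD -EFinM -EFinD lee_fin.
    have Phi1 : 0 < Phi + 1 by rewrite ltr_wpDl.
    rewrite -subr_ge0.
    have -> : K * E * (M + Phi) * N + e -
        K * E * (M * N + (N + e / (K * E * (Phi + 1))) * Phi) = e / (Phi + 1).
      by field; rewrite !gt_eqF.
    by rewrite divr_ge0 // ltW.
  move=> delta0.
  apply: (@le_trans _ _ (\int[pi]_x ((K * E)%:E *
     ((phi x)%:E * \int[P t x]_y (h y)%:E + (N + delta)%:E * (phi x)%:E)))%E).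
    apply: ge0_le_integral => //.
    - by move=> x _; rewrite lee_fin powR_ge0.
    - apply/measurable_EFinP.
      exact: measurableT_comp (measurable_powR p) (measurable_semigroup _ _ _ _ _).
    - apply: measurable_funeM; apply: emeasurable_funD.
        exact: emeasurable_funM.
      exact: measurable_funeM.
    move=> x _.
    (* The coupling is chosen separately at each [x]; only the resulting bound, which no longer
       mentions it, is integrated. *)
    have [dV [V [Q [Z1 [Z2 [couple ZE]]]]]] := coup x.
    have [mD ] := ZE t t0; rewrite expectation.unlock => hB.
    have B0 : 0 < C * expR (- (beta * t)) * phi x by rewrite !mulr_gt0 // expR_gt0.
    apply: le_trans (semigroup_pointwise_bound P pi phi Q Z1 Z2 t x f p _
      (N + delta) inv_pi couple t0 mD mphi phi_ge1 hB B0 hp hf _) _.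
      by rewrite -/u NE lte_fin ltrDl.
    rewrite (muleC (N + delta)%:E) -ge0_muleDr //; last first.
      by rewrite lee_fin addr_ge0 // ltW.
    rewrite muleA -EFinM lee_wpmul2r //.
      by rewrite adde_ge0 // lee_fin addr_ge0 // ltW.
    by rewrite lee_fin /K /E !mulrA.
  have Nd0 : 0 <= N + delta by rewrite addr_ge0 // ltW.
  have mphiPh : measurable_fun [set: T]
      (fun x => (phi x)%:E * \int[P t x]_y (h y)%:E)%E by exact: emeasurable_funM.
  have mNphi : measurable_fun [set: T] (fun x => (N + delta)%:E * (phi x)%:E)%E.
    exact: measurable_funeM.
  have phiPh0 x : (0 <= (phi x)%:E * \int[P t x]_y (h y)%:E)%E.
    by rewrite mule_ge0 // lee_fin ltW.
  have Nphi0 x : (0 <= (N + delta)%:E * (phi x)%:E)%E.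
    by rewrite mule_ge0 // lee_fin ltW.
  rewrite ge0_integralZl //; last 3 first.
  - exact: emeasurable_funD.
  - by move=> x _; rewrite adde_ge0.
  - by rewrite lee_fin ltW.
  rewrite ge0_integralD // lee_wpmul2l //; first by rewrite lee_fin ltW.
  rewrite leeD // ge0_integralZl //; last by move=> x _; rewrite lee_fin ltW.
  by rewrite /Phi fineK.
rewrite !cLnormE -/u NE.
have p'0 : 0 <= p^-1 by rewrite invr_ge0 ltW.
have MPhi0 : 0 <= M + Phi by rewrite addr_ge0 // ltW.
apply: le_trans (gt0_ler_poweR p'0 _ _ int_bound) _.
- by rewrite in_itv /= leey andbT integral_ge0 // => x _; rewrite lee_fin powR_ge0.
- by rewrite in_itv /= leey andbT lee_fin !mulr_ge0 // ltW.
rewrite !poweR_EFin -EFinM lee_fin.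
have -> : K * E * (M + Phi) * N = K * (M + Phi) * E * N by ring.
have KM0 : 0 <= K * (M + Phi) by rewrite mulr_ge0 // ltW.
rewrite powRM //; last by rewrite mulr_ge0 // ltW.
rewrite (powRM _ KM0 (ltW E0)).
rewrite ler_wpM2r ?powR_ge0 // ler_wpM2l ?powR_ge0 //.
(* The root of order [p] turns the rate [beta] into [beta / p], and [gamma_le] says that [gamma]
   does not exceed it. *)
rewrite /E -expRM ler_expR mulNr lerN2 -mulrA (mulrC t) mulrA.
by rewrite ler_wpM2r // ler_pdivlMr.
Qed.
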